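(* Let $X$ and $Y$ be real Banach spaces and let $A$ be a nonempty open subset of $X$. For each $t \in \mathbb{N}$ let $u_t : A \times A \rightarrow \mathbb{R}$, and for each $t \in \mathbb{N}_*$ let $g_t : A \rightarrow Y$. Fix $\sigma \in A$ and $\beta \in (0,1)$. Let $\underline{\hat{x}} = (\hat{x}_t)_{t \in \mathbb{N}}$ be a solution of the problem $$(\mathcal{V}) \quad \text{Maximize } J(\underline{x}) := \sum_{t=0}^{+\infty} \beta^t u_t(x_t, x_{t+1}) \text{ subject to } \underline{x} \in \ell^{\infty}(\mathbb{N}, A),\ x_0 = \sigma,\ \text{and } g_t(x_t) = 0 \text{ for all } t \in \mathbb{N}_*.$$ Assume that the following conditions are fulfilled. (A1) $(\hat{x}_t, \hat{x}_{t+1})_{t \in \mathbb{N}} \in \mathrm{Int}\, \ell^{\infty}(\mathbb{N}, A \times A)$. (A2) For all $t \in \mathbb{N}$, $u_t \in C^1(A \times A, \mathbb{R})$. (A3) For all $(\underline{x}, \underline{y}) \in \mathrm{Int}\, \ell^{\infty}(\mathbb{N}, A \times A)$, $(u_t(x_t,y_t))_{t \in \mathbb{N}} \in \ell^{\infty}(\mathbb{N}, \mathbb{R})$. (A4) For all $(\underline{x}, \underline{y}) \in \mathrm{Int}\, \ell^{\infty}(\mathbb{N}, A \times A)$, $(Du_t(x_t,y_t))_{t \in \mathbb{N}} \in \ell^{\infty}(\mathbb{N}, (X \times X)^* )$. (A5) $(Du_t)_{t \in \mathbb{N}}$ is uniformly equicontinuous on the bounded subsets of $A \times A$. (A6) $\underline{\hat{x}}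 \in \mathrm{Int}\, \ell^{\infty}(\mathbb{N}, A)$. (A7) For all $t \in \mathbb{N}_*$, $g_t \in C^1(A, Y)$. (A8) For all $\underline{x} \in \mathrm{Int}\, \ell^{\infty}(\mathbb{N}_*, A)$, $(g_t(x_t))_{t \in \mathbb{N}_*} \in \ell^{\infty}(\mathbb{N}_*, Y)$. (A9) For all $\underline{x} \in \mathrm{Int}\, \ell^{\infty}(\mathbb{N}_*, A)$, $(Dg_t(x_t))_{t \in \mathbb{N}_*} \in \ell^{\infty}(\mathbb{N}_*, \mathcal{L}(X,Y))$. (A10) $(Dg_t)_{t \in \mathbb{N}_*}$ is uniformly equicontinuous on the bounded subsets of $A$. (A11) For all $t \in \mathbb{N}_*$, there exists a closed vector subspace $S_t$ of $X$ such that $X = \mathrm{Ker}\, Dg_t(\hat{x}_t) \oplus S_t$, and $\mathrm{Im}\, Dg_t(\hat{x}_t)$ is closed and there exists a closed vector subspace $W_t$ of $Y$ such that $Y = \mathrm{Im}\, Dg_t(\hat{x}_t) \oplus W_t$. (A12) $\sup_{t \in \mathbb{N}_*} c(Dg_t(\hat{x}_t)) < +\infty$. (A13) There exists $r > 0$ such that for all $\underline{x} \in B_{\infty}(\underline{\hat{x}}, r)$ and all $t \in \mathbb{N}_*$, $\mathrm{Im}\, Dg_t(x_t) \cap W_t = \{0\}$. Then there exists a sequence $(p_t)_{t \in \mathbb{N}_*} \in \ell^1(\mathbb{N}_*, Y^* )$ which satisfies, for all $t \in \mathbb{N}_*$, $$\beta^t D_1 u_t(\hat{x}_t, \hat{x}_{t+1})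 + \beta^{t-1} D_2 u_{t-1}(\hat{x}_{t-1}, \hat{x}_t) = p_t \circ Dg_t(\hat{x}_t).$$
   Context: $\mathbb{N}_* := \mathbb{N} \setminus \{0\}$ (with $0 \in \mathbb{N}$). For $\Omega \in \{\mathbb{N}, \mathbb{N}_*\}$ and a normed space $E$, $\ell^{\infty}(\Omega, E)$ is the space of bounded sequences $\underline{x} = (x_t)_{t \in \Omega}$ in $E$ with norm $\Vert \underline{x} \Vert_{\infty} := \sup_{t \in \Omega} \Vert x_t \Vert$; for $A \subset E$, $\ell^{\infty}(\Omega, A)$ is the set of those $\underline{x} \in \ell^{\infty}(\Omega, E)$ with $x_t \in A$ for all $t$, and $\mathrm{Int}$ denotes its topological interior in $\ell^{\infty}(\Omega, E)$. A pair $(\underline{x},\underline{y})$ of sequences is identified with the sequence of pairs $((x_t,y_t))_t$, and $X \times X$ carries a standard product norm. $\ell^1(\Omega, E)$ is the set of sequences in $E$ with $\sum_{t \in \Omega} \Vert x_t \Vert < +\infty$. $B_{\infty}(\underline{x}, r) := \{ \underline{u} \in \ell^\infty(\Omega,E) : \Vert \underline{u} - \underline{x} \Vert_{\infty} < r \}$ (in (A13), $r$ is understood to be small enough that this ball, with $\Omega=\mathbb{N}$, $E = X$, lies in $\ell^\infty(\mathbb{N},A)$). $\mathcal{L}(X,Y)$ is the space of continuous linear maps with the operator norm; $^*$ denotes the topological dual; $D$ is Fréchet differentiation and $D_1, D_2$ are the partial Fréchet differentials with respect to the first and second variable. $C^1(A,Y)$ is the space of continuously Fréchet differentiable maps. The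 symbol $\oplus$ denotes topological direct sum of closed subspaces: $(x_1,x_2) \mapsto x_1+x_2$ is an isomorphism of topological vector spaces from the product onto the whole space. A sequence $(h_t)_{t}$ of maps from a subset $A$ of a normed space to a normed space is uniformly equicontinuous on the bounded subsets of $A$ when for every bounded $B \subset A$ and every $\epsilon > 0$ there is $\eta_{B,\epsilon} > 0$ such that for all $u, v \in B$ with $\Vert u - v \Vert \leq \eta_{B,\epsilon}$ one has $\Vert h_t(u) - h_t(v) \Vert \leq \epsilon$ for all $t$. For $L \in \mathcal{L}(X,Y)$ with closed image, $c(L) > 0$ denotes a constant such that for every $y \in \mathrm{Im}\, L$ there is $x_y \in X$ with $L(x_y) = y$ and $\Vert x_y \Vert \leq c(L) \Vert y \Vert$ (such a constant exists because $\mathrm{Im}\, L$ is closed); the condition $\sup_t c(L_t) < +\infty$ means that such constants can be chosen bounded in $t$. A solution of $(\mathcal{V})$ is a sequence $\underline{\hat{x}}$ satisfying the constraints, for which the series $J(\underline{\hat{x}})$ converges, and such that $J(\underline{\hat{x}}) \geq J(\underline{x})$ for every $\underline{x}$ satisfying the constraints for which the series $J(\underline{x})$ converges. *)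

(* Defs.v *)
From HB Require Import structures.
From mathcomp Require Import all_boot all_order all_algebra.
From mathcomp Require Import all_classical all_reals all_analysis.

Set Implicit Arguments.
Unset Strict Implicit.
Unset Printing Implicit Defensive.

Import Order.TTheory GRing.Theory Num.Theory.
Import numFieldNormedType.Exports.

Local Open Scope classical_set_scope.
Local Open Scope ring_scope.

Record Nstar := MkNstar { Nstar_val :> nat; Nstar_gt0 : (0 < Nstar_val)%N }.

HB.instance Definition _ := [isSub for Nstar_val].
HB.instance Definition _ := [Countable of Nstar by <:].

Lemma bounded_funE (I : Type) (R : realType) (E : normedModType R)
    (x : I -> E) : bounded_fun x <-> exists M, forall i, `|x i| <= M.
Proof.
split=> [[M [_ xM]]|[M xM]].
  by exists (M + 1) => i; apply: (xM (M + 1)) => //; rewrite ltrDl.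
exists M; split; first exact: num_real.
by move=> M' MM' i _ /=; rewrite (le_trans (xM i))// ltW.
Qed.

Section linf.
Context (I : Type) (R : realType) (E : normedModType R).

Definition linf_pred : {pred I -> E} := fun x => `[< bounded_fun x >].

Record linf := MkLinf {
  linf_fun :> I -> E;
  linf_subproof : linf_fun \in linf_pred }.

HB.instance Definition _ := [isSub for linf_fun].
HB.instance Definition _ := [Choice of linf by <:].

Lemma linf_bounded (x : linf) : bounded_fun x.
Proof. exact/asboolP/(valP x). Qed.

Fact linf_submod_closed : submod_closed linf_pred.
Proof.
split.
  apply/asboolP/bounded_funE; exists 0 => i.
  by rewrite -[X in X i]/(cst 0) normr0.
move=> a x y /asboolP/bounded_funE[M xM] /asboolP/bounded_funE[N yN].
apply/asboolP/bounded_funE; exists (`|a| * M + N) => i.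
by rewrite (le_trans (ler_normD _ _))// lerD// normrZ ler_wpM2l.
Qed.

HB.instance Definition _ :=
  GRing.isSubmodClosed.Build R (I -> E) linf_pred linf_submod_closed.
HB.instance Definition _ := [SubChoice_isSubLmodule of linf by <:].

Definition linf_norm (x : linf) : R := sup [set `|x i| | i in [set: I]].

Lemma linf_norm_ub (x : linf) i : `|x i| <= linf_norm x.
Proof.
have /bounded_funE[M xM] := linf_bounded x.
by apply: ub_le_sup; [exists M => _ [j _ <-]|exists i].
Qed.

Lemma linf_norm_le (x : linf) M :
  0 <= M -> (forall i, `|x i| <= M) -> linf_norm x <= M.
Proof.
move=> M0 xM; rewrite /linf_norm.
have [->|/set0P S0] := eqVneq [set `|x i| | i in [set: I]] set0.
  by rewrite sup0.
by apply: ge_sup => // _ [i _ <-].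
Qed.

Lemma linf_norm_ge0 (x : linf) : 0 <= linf_norm x.
Proof.
have [S0|/set0P[_ [i _ _]]] := eqVneq [set `|x i| | i in [set: I]] set0.
  by rewrite /linf_norm S0 sup0.
exact: le_trans (linf_norm_ub x i).
Qed.

Fact linf_normD x y : linf_norm (x + y) <= linf_norm x + linf_norm y.
Proof.
apply: linf_norm_le => [|i]; first by rewrite addr_ge0 ?linf_norm_ge0.
by rewrite (le_trans (ler_normD _ _))// lerD ?linf_norm_ub.
Qed.

Fact linf_normZ (a : R) x : linf_norm (a *: x) = `|a| * linf_norm x.
Proof.
have le b y : linf_norm (b *: y) <= `|b| * linf_norm y.
  apply: linf_norm_le => [|i]; first by rewrite mulr_ge0 ?linf_norm_ge0.
  by rewrite normrZ ler_wpM2l ?linf_norm_ub.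
apply/eqP; rewrite eq_le le/=.
have [->|a0] := eqVneq a 0; first by rewrite normr0 mul0r linf_norm_ge0.
rewrite -ler_pdivlMl ?normr_gt0// -normfV.
by rewrite -{1}[x]scale1r -(mulVf a0) -scalerA le.
Qed.

Fact linf_norm0_eq0 x : linf_norm x = 0 -> x = 0.
Proof.
move=> x0; apply/val_inj/funext => i; apply/eqP.
by rewrite -normr_le0 -x0 linf_norm_ub.
Qed.

HB.instance Definition _ :=
  Lmodule_isNormed.Build R linf linf_normD linf_normZ linf_norm0_eq0.

Definition linf_set (A : set E) : set linf := [set x | forall i, A (x i)].

(* Int l^oo(I, A), as a set of (necessarily bounded) plain families *)
Definition linf_int (A : set E) : set (I -> E) :=
  [set linf_fun x | x in (linf_set A)°].

End linf.

Section clin.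
Context (R : realType) (X Y : normedModType R).

Definition clin_pred : {pred X -> Y} :=
  fun f => `[< linear f /\ continuous f >].

Record clin := MkClin {
  clin_fun :> X -> Y;
  clin_subproof : clin_fun \in clin_pred }.

HB.instance Definition _ := [isSub for clin_fun].
HB.instance Definition _ := [Choice of clin by <:].

Lemma clin_linear (f : clin) : linear f.
Proof. by have /asboolP[] := valP f. Qed.

Lemma clin_continuous (f : clin) : continuous f.
Proof. by have /asboolP[] := valP f. Qed.

HB.instance Definition _ (f : clin) :=
  GRing.isLinear.Build R X Y *:%R f (clin_linear f).

Fact clin_submod_closed : submod_closed clin_pred.
Proof.
split.
  apply/asboolP; split; last by move=> x; exact: cvg_cst.
  by move=> a x y; rewrite /= -[0]/(cst 0) /= scaler0 addr0.
move=> a f g /asboolP[lf cf] /asboolP[lg cg]; apply/asboolP; split.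
  move=> b x y; rewrite -[_ + _]/(fun z => a *: f z + g z) /=.
  by rewrite lf lg !scalerDr !scalerA mulrC addrACA.
by move=> x; apply: cvgD; [apply: cvgZr; exact: cf|exact: cg].
Qed.

HB.instance Definition _ :=
  GRing.isSubmodClosed.Build R (X -> Y) clin_pred clin_submod_closed.
HB.instance Definition _ := [SubChoice_isSubLmodule of clin by <:].

Definition clin_norm (f : clin) : R :=
  sup [set `|f x| | x in [set x : X | `|x| <= 1]].

Lemma clin_bounded (f : clin) :
  exists2 M, 0 <= M & forall x, `|x| <= 1 -> `|f x| <= M.
Proof.
have /linear_bounded_continuous/bounded_funP/(_ 1)[M fM] :=
  @clin_continuous f.
by exists M => //; apply: le_trans (fM 0 _); rewrite ?normr0.
Qed.

Lemma clin_norm_ge0 (f : clin) : 0 <= clin_norm f.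
Proof.
have [M M0 fM] := clin_bounded f.
apply: (@le_trans _ _ `|f 0|) => //; apply: ub_le_sup.
  by exists M => _ [x /= x1 <-]; exact: fM.
by exists 0 => //=; rewrite normr0.
Qed.

Lemma clin_norm_ub (f : clin) x : `|f x| <= clin_norm f * `|x|.
Proof.
have [M M0 fM] := clin_bounded f.
have [->|x0] := eqVneq x 0; first by rewrite linear0 !normr0 mulr0.
have nx0 : 0 < `|x| by rewrite normr_gt0.
rewrite -ler_pdivrMr// mulrC -[X in X * _]ger0_norm ?invr_ge0// -normrZ.
rewrite -linearZ; apply: ub_le_sup.
  by exists M => _ [y /= y1 <-]; exact: fM.
exists (`|x|^-1 *: x) => //=.
by rewrite normrZ ger0_norm ?invr_ge0// mulVf ?gt_eqF.
Qed.

Lemma clin_norm_le (f : clin) M :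
  0 <= M -> (forall x, `|f x| <= M * `|x|) -> clin_norm f <= M.
Proof.
move=> M0 fM; apply: ge_sup; first by exists `|f 0|, 0 => //=; rewrite normr0.
by move=> _ [x /= x1 <-]; rewrite (le_trans (fM x))// ler_piMr.
Qed.

Fact clin_normD f g : clin_norm (f + g) <= clin_norm f + clin_norm g.
Proof.
apply: clin_norm_le => [|x]; first by rewrite addr_ge0 ?clin_norm_ge0.
by rewrite mulrDl (le_trans (ler_normD _ _))// lerD ?clin_norm_ub.
Qed.

Fact clin_normZ (a : R) f : clin_norm (a *: f) = `|a| * clin_norm f.
Proof.
have le b g : clin_norm (b *: g) <= `|b| * clin_norm g.
  apply: clin_norm_le => [|x]; first by rewrite mulr_ge0 ?clin_norm_ge0.
  by rewrite normrZ -mulrA ler_wpM2l ?clin_norm_ub.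
apply/eqP; rewrite eq_le le/=.
have [->|a0] := eqVneq a 0; first by rewrite normr0 mul0r clin_norm_ge0.
rewrite -ler_pdivlMl ?normr_gt0// -normfV.
by rewrite -{1}[f]scale1r -(mulVf a0) -scalerA le.
Qed.

Fact clin_norm0_eq0 f : clin_norm f = 0 -> f = 0.
Proof.
move=> f0; apply/val_inj/funext => x; apply/eqP.
by rewrite -normr_le0 (le_trans (clin_norm_ub f x))// f0 mul0r.
Qed.

HB.instance Definition _ :=
  Lmodule_isNormed.Build R clin clin_normD clin_normZ clin_norm0_eq0.

End clin.

Notation "''L' ( X , Y )" := (@clin _ X Y)
  (at level 8, format "''L' ( X ,  Y )") : type_scope.

Section differential.
Context (R : realType) (X Y : normedModType R).

(* The library's ['d f x] is a mere linear map, defined for every f; it is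
   continuous as soon as f is differentiable at x (see [DE]). *)
Definition D (f : X -> Y) (x : X) : 'L(X, Y) := insubd 0 ('d f x : X -> Y).

Lemma DE f x : differentiable f x -> D f x = 'd f x :> (X -> Y).
Proof.
move=> dfx; rewrite /D /insubd insubT//.
by apply/asboolP; split; [exact: linearP|exact: diff_continuous].
Qed.

Definition C1 (A : set X) (f : X -> Y) :=
  (forall x, A x -> differentiable f x) /\ {within A, continuous (D f)}.

Definition bounded_unif_equicontinuous (I : Type) (A : set X)
    (h : I -> X -> Y) :=
  forall B : set X, bounded_set B -> B `<=` A ->
  forall eps : R, 0 < eps -> exists2 eta : R, 0 < eta &
    forall u v, B u -> B v -> `|u - v| <= eta ->
    forall t, `|h t u - h t v| <= eps.

End differential.

Section partial_differentials.
Context (R : realType) (X1 X2 Y : normedModType R).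

Definition D1 (f : X1 * X2 -> Y) (z : X1 * X2) : 'L(X1, Y) :=
  D (fun x => f (x, z.2)) z.1.
Definition D2 (f : X1 * X2 -> Y) (z : X1 * X2) : 'L(X2, Y) :=
  D (fun y => f (z.1, y)) z.2.

End partial_differentials.

Section subspaces.
Context (R : realType) (E : normedModType R).

Definition closed_subspace (U : set E) :=
  [/\ closed U, U 0 & forall (a : R) x y, U x -> U y -> U (a *: x + y)].

(* [s] is the inverse of the (continuous) map (x1, x2) |-> x1 + x2 from
   U * V to E *)
Definition is_topological_direct_sum (U V : set E) :=
  [/\ closed_subspace U, closed_subspace V &
    exists s : E -> E * E, [/\ continuous s,
      forall x, (U `*` V) (s x),
      forall x, (s x).1 + (s x).2 = x &
      forall z, (U `*` V) z -> s (z.1 + z.2) = z]].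

End subspaces.

Section linear_maps.
Context (R : realType) (X Y : normedModType R).

Definition ker (L : 'L(X, Y)) : set X := [set x | L x = 0].

(* "c is an admissible c(L)" *)
Definition is_preimage_constant (L : 'L(X, Y)) (c : R) :=
  0 < c /\ forall y, range L y -> exists2 x, L x = y & `|x| <= c * `|y|.

End linear_maps.

Definition l1 (I : choiceType) (R : realType) (E : normedModType R)
    (p : I -> E) :=
  (\esum_(t in [set: I]) `|p t|%:E < +oo)%E.

Section problem.
Context (R : realType) (X Y : normedModType R) (A : set X).
Context (u : nat -> X * X -> R^o) (g : Nstar -> X -> Y).
Context (sigma : X) (beta : R).

Definition feasible (x : linf nat X) :=
  [/\ linf_set A x, x 0%N = sigma & forall t : Nstar, g t (x t) = 0].

Definition J_series (x : linf nat X) : R^nat :=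
  series (fun t => beta ^+ t * u t (x t, x t.+1)).

Definition J (x : linf nat X) : R := limn (J_series x).

Definition is_solution (xhat : linf nat X) :=
  [/\ feasible xhat, cvgn (J_series xhat) &
    forall x, feasible x -> cvgn (J_series x) -> J x <= J xhat].

End problem.

(* Main.v *)
Require Import Defs.
From HB Require Import structures.
From mathcomp Require Import all_boot all_order all_algebra.
From mathcomp Require Import all_classical all_reals all_analysis.
From mathcomp Require Import ring lra.

(**
  Only one coordinate x_t is ever varied, so neither the uniformity in t nor
  the l^oo topology matters for the first-order condition.  Fix t, put
  L = D g_t(xhat_t) and let h be in Ker L.  With P the projection of Y onto
  Im L along W_t and T a bounded right inverse of L on Im L, a contraction
  argument solves P (g_t (xhat_t + s h + T (y s))) = 0 with y s = o(s).  Along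
  this curve g_t stays in W_t while its increments lie, up to first order, in
  the range of D g_t; (A13) therefore makes the derivative of g_t along the
  curve vanish, so the curve is feasible.  Optimality then shows that
    w_t = beta^t D_1 u_t + beta^(t-1) D_2 u_(t-1)
  vanishes on Ker L.  Finally p_t is the Hahn-Banach extension of L x |-> w_t x
  from Im L to Y: its norm is at most c(L) |w_t| = O(beta^t), which is summable
  by (A4) and (A12), whereas the projections onto Im L need not be uniformly
  bounded.
*)

Set Implicit Arguments.
Unset Strict Implicit.
Unset Printing Implicit Defensive.

Import Order.TTheory GRing.Theory Num.Theory.
Import numFieldNormedType.Exports.

Local Open Scope classical_set_scope.
Local Open Scope ring_scope.

(** * The Hahn-Banach theorem *)

Section bounded_linear.
Context (R : realType) (X Y : normedModType R).

Lemma clin_of_bounded (f : X -> Y) (M : R) :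
  linear f -> (forall x, `|f x| <= M * `|x|) ->
  exists F : 'L(X, Y), F = f :> (X -> Y).
Proof.
move=> lf fM.
pose flM := GRing.isLinear.Build R X Y *:%R f lf.
pose fl : {linear X -> Y} := HB.pack f flM.
suff : f \in @clin_pred R X Y by move=> fP; exists (MkClin fP).
apply/asboolP; split => //.
apply: (@bounded_linear_continuous R X Y fl).
apply/linear_boundedP => /=; near=> M'; move=> x.
apply: (le_trans (fM x)); rewrite ler_wpM2r//.
Unshelve. all: by end_near. Qed.

(** The bound is strictly positive even when [f] is zero, so that later constants may divide by
    it. *)
Lemma clin_bound_gt0 (f : 'L(X, Y)) :
  exists2 M : R, 0 < M & forall x, `|f x| <= M * `|x|.
Proof.
exists (clin_norm f + 1); first by rewrite ltr_wpDl ?clin_norm_ge0.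
move=> x; rewrite (le_trans (clin_norm_ub f x))// ler_wpM2r//.
by rewrite lerDl.
Qed.

End bounded_linear.

Section hahn_banach.
Context (R : realType) (E : normedModType R) (M : R).

(* The graph of a partial linear form dominated by [M] times the norm; the
   bound at [0] makes such a relation single-valued. *)
Definition dominated_graph (G : set (E * R^o)) :=
  [/\ G 0, forall (a : R) z w, G z -> G w -> G (a *: z + w) &
      forall z, G z -> `|z.2| <= M * `|z.1|].

Lemma dominated_graphD (G : set (E * R^o)) x r y s a : dominated_graph G ->
  G (x, r) -> G (y, s) -> G (a *: x + y, a * r + s).
Proof. by move=> [_ GD _] Gxr Gys; exact: (GD a _ _ Gxr Gys). Qed.

Lemma dominated_graph_uniq (G : set (E * R^o)) x r s : dominated_graph G ->
  G (x, r) -> G (x, s) -> r = s.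
Proof.
move=> GG Gr Gs; have [_ _ GM] := GG.
have := GM _ (dominated_graphD (-1) GG Gr Gs) => /=.
rewrite scaleN1r addNr normr0 mulr0 normr_le0 mulN1r addrC subr_eq0.
by move/eqP.
Qed.

(** The one-dimensional step: a value at [x0] must lie above every [r - M * |x - x0|] and below
    every [s + M * |y - x0|]. Domination of [G] and the triangle inequality make these bounds
    compatible, and the supremum of the lower ones is a valid value; if [x0] is already in the
    domain, the two bounds meet there. *)
Lemma dominated_graph_extension (G : set (E * R^o)) (x0 : E) : 0 <= M ->
  dominated_graph G ->
  exists c : R, dominated_graph
    [set z | exists x r a, G (x, r) /\ z = (x + a *: x0, r + a * c)].
Proof.
move=> M0 GG; have [G0 _ GM] := GG.
pose B := [set z.2 - M * `|z.1 - x0| | z in G].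
have B_ub z w : G z -> G w -> z.2 - M * `|z.1 - x0| <= w.2 + M * `|w.1 - x0|.
  case: z w => [x r] [y s] Gxr Gys /=.
  have := GM _ (dominated_graphD (-1) GG Gys Gxr) => /= /ler_normlW.
  rewrite mulN1r scaleN1r => H.
  have : M * `|- y + x| <= M * (`|x - x0| + `|y - x0|).
    rewrite ler_wpM2l// (le_trans _ (ler_normB _ _))//.
    by rewrite opprB addrA subrK addrC.
  rewrite mulrDr; move: H; lra.
have BM : has_sup B.
  split; first by exists (0 - M * `|0 - x0|); exists 0.
  by exists (0 + M * `|0 - x0|) => _ [z Gz <-]; exact: B_ub Gz G0.
have supM x r : G (x, r) -> `|r - sup B| <= M * `|x - x0|.
  move=> Gxr.
  have h1 : sup B <= r + M * `|x - x0|.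
    apply: ge_sup; first by case: BM.
    by move=> _ [z Gz <-]; exact: B_ub Gz Gxr.
  have h2 : r - M * `|x - x0| <= sup B.
    by apply: ub_le_sup; [case: BM|exists (x, r)].
  by rewrite ler_norml; apply/andP; split; lra.
exists (sup B); split.
- by exists 0, 0, 0; split => //; rewrite scale0r mul0r !addr0.
- move=> a _ _ [x [r [b [Gxr ->]]]] [y [s [d [Gys ->]]]].
  exists (a *: x + y), (a * r + s), (a * b + d); split.
    exact: dominated_graphD.
  congr (_, _) => /=.
    by rewrite scalerDr scalerDl scalerA addrACA.
  rewrite -[_ *: _]/(a * _); ring.
- move=> _ [x [r [a [Gxr ->]]]] /=.
  have [->|a0] := eqVneq a 0.
    by rewrite scale0r mul0r !addr0; exact: (GM (x, r)).
  (* Dividing by [- a] reduces the bound at [x + a x0] to [supM], which is two-sided, so the sign of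
     [a] does not matter. *)
  have G' : G ((- a^-1) *: x, (- a^-1) * r).
    by have := dominated_graphD (- a^-1) GG Gxr G0; rewrite !addr0.
  have -> : r + a * sup B = - a * (- a^-1 * r - sup B) by field.
  have -> : x + a *: x0 = - a *: (- a^-1 *: x - x0).
    by rewrite scalerBr scalerA mulrNN divff// scale1r scaleNr opprK.
  by rewrite normrM normrZ mulrCA ler_wpM2l// supM.
Qed.

Theorem hahn_banach (G : set (E * R^o)) : 0 <= M -> dominated_graph G ->
  exists F : 'L(E, R^o), (forall x, `|F x| <= M * `|x|) /\
    forall x r, G (x, r) -> F x = r.
Proof.
move=> M0 GG.
(* Zorn ranges over the sets [A] with [G] union [A] dominated, not over the graphs containing [G]:
   the empty chain, whose union is empty, is then covered too. *)
have [F FP totF|A [GA Amax]] :=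
    @Zorn_bigcup _ [set A | dominated_graph (G `|` A)].
  split; first by left; case: GG.
  - move=> a z w [Gz|[A FA Az]] [Gw|[B FB Bw]].
    + by left; case: GG => _ + _; exact.
    + have [_ GD _] := FP B FB.
      have [|Bzw] := GD a z w (or_introl Gz) (or_intror Bw); first by left.
      by right; exists B.
    + have [_ GD _] := FP A FA.
      have [|Azw] := GD a z w (or_intror Az) (or_introl Gw); first by left.
      by right; exists A.
    + have [AB|BA] := totF _ _ FA FB.
        have [_ GD _] := FP B FB.
        have [|Bzw] := GD a z w (or_intror (AB _ Az)) (or_intror Bw).
          by left.
        by right; exists B.
      have [_ GD _] := FP A FA.
      have [|Azw] := GD a z w (or_intror Az) (or_intror (BA _ Bw)).
        by left.
      by right; exists A.
  - move=> z [Gz|[A FA Az]]; first by case: GG => _ _; exact.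
    by have [_ _] := FP A FA; apply; right.
set H := G `|` A in GA.
(* A maximal graph is defined everywhere: at a missing [x] the extension by one dimension would
   contain the new point [(x, c)]. *)
have domH x : exists r, H (x, r).
  apply: contrapT => nHx.
  have [c] := dominated_graph_extension x M0 GA.
  set H' := [set z | _] => GH'.
  have HH' : H `<=` H'.
    move=> [y r] Hyr; exists y, r, 0; split => //.
    by rewrite scale0r mul0r !addr0.
  apply: (Amax H'); last first.
    rewrite /= (_ : G `|` H' = H') //.
    by apply/setUidPr => z Gz; apply: HH'; left.
  split; first by move=> z Az; apply: HH'; right.
  move=> /(_ (x, c)) H'A; apply: nHx; exists c; right; apply: H'A.
  exists 0, 0, 1; split; first by case: GA.
  by rewrite scale1r mul1r !add0r.
pose f (x : E) : R^o := sval (cid (domH x)).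
have Hf x : H (x, f x) by rewrite /f; case: cid.
have lf : linear f.
  move=> a x y; apply: (dominated_graph_uniq GA (Hf _)).
  exact: (dominated_graphD a GA (Hf x) (Hf y)).
have fM x : `|f x| <= M * `|x| by have [_ _ /(_ _ (Hf x))] := GA.
have [F Ff] := clin_of_bounded lf fM.
exists F; rewrite Ff; split => // x r Gxr.
by apply: (dominated_graph_uniq GA (Hf _)); left.
Qed.

End hahn_banach.

(** * Differential calculus *)

Section differentials.
Context (R : realType) (X Y : normedModType R).

Lemma differentiable_near (f : X -> Y) x : differentiable f x ->
  forall e : R, 0 < e ->
  \forall y \near x, `|f y - f x - 'd f x (y - x)| <= e * `|y - x|.
Proof.
move=> /diffP[_ /= df] e e0.
have /eqaddoP/(_ e e0) : f = (fun y => f (lim (nbhs x)) + 'd f x (y - lim (nbhs x)))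
   +o_ (nbhs x) (fun y => y - lim (nbhs x)).
  by apply: eqaddoE; rewrite funeqE => y; exact: df.
apply: filter_app; near=> y.
by rewrite lim_id//= opprD addrA.
Unshelve. all: by end_near. Qed.

Lemma near_differentiable (f : X -> Y) x (L : 'L(X, Y)) :
  (forall e : R, 0 < e ->
     \forall y \near x, `|f y - f x - L (y - x)| <= e * `|y - x|) ->
  differentiable f x /\ 'd f x = L :> (X -> Y).
Proof.
move=> fL.
have LE : f \o shift x = cst (f x) + L +o_ (0 : X) id.
  apply/eqaddoP => e e0.
  have := fL _ e0; rewrite (near_shift 0 x) subr0; apply: filter_app.
  by near=> y; rewrite /= addrK opprD addrA.
have dE : 'd f x = L :> (X -> Y).
  exact: (@diff_unique _ _ _ f L _ (@clin_continuous _ _ _ L) LE).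
split => //; apply/diff_locallyP; rewrite dE; split => //.
exact: clin_continuous.
Unshelve. all: by end_near. Qed.

(** Hahn-Banach with constant 1, applied to [a v |-> a |v|] on the line through [v]. It reduces
    vector-valued estimates to scalar ones. *)
Lemma norming_functional (v : X) : exists F : 'L(X, R^o),
  (forall x, `|F x| <= `|x|) /\ F v = `|v|.
Proof.
have [|F [F1 Fv]] := @hahn_banach R X 1
    [set (a *: v, a * `|v|) | a in [set: R]] ler01.
  split.
  - by exists 0 => //; rewrite scale0r mul0r.
  - move=> a _ _ [b _ <-] [c _ <-]; exists (a * b + c) => //.
    by congr (_, _) => /=; rewrite ?scalerDl ?scalerA ?mulrDl// -mulrA.
  - by move=> _ [a _ <-] /=; rewrite mul1r !normrZ normr_id.
exists F; split=> [x|]; first by rewrite (le_trans (F1 x))// mul1r.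
by apply: Fv; exists 1 => //; rewrite scale1r mul1r.
Qed.

End differentials.

Section mean_value.
Context (R : realType) (X Y : normedModType R).

(** A functional norming [f b - f a] turns [f] along the segment into a real function, to which the
    scalar mean value theorem applies. *)
Lemma mean_value_inequality (f : X -> Y) (M : R) a b :
  (forall s : R, 0 <= s <= 1 -> differentiable f (a + s *: (b - a)) /\
     `|'d f (a + s *: (b - a)) (b - a)| <= M) ->
  `|f b - f a| <= M.
Proof.
move=> df.
have [F [F1 Fv]] := norming_functional (f b - f a).
pose p (s : R) := a + s *: (b - a).
have dp (s : R) : is_diff s p (fun r => r *: (b - a)).
  rewrite /p; apply: is_diff_eq; rewrite add0r //.
have dpsi (s : R) : 0 <= s <= 1 ->
    is_diff s (F \o (f \o p) : R -> R^o) (fun r => F ('d f (p s) (r *: (b - a)))).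
  move=> /df[dfs _].
  have dfP := differentiableP dfs.
  have dF : is_diff (f (p s)) F F.
    apply: DiffDef; first exact/linear_differentiable/clin_continuous.
    exact/diff_lin/clin_continuous.
  exact: is_diff_comp.
have psi1 (s : R) : 0 <= s <= 1 ->
    is_derive s 1 (F \o (f \o p) : R -> R) (F ('d f (p s) (b - a))).
  move=> /dpsi d; split; first exact/derivable1_diffP/ex_diff.
  by rewrite deriveE// diff_val scale1r.
have [||c c01] := @MVT_segment R (F \o (f \o p))
  (fun s => F ('d f (p s) (b - a))) 0 1 ler01.
  by move=> s s01; apply: psi1; rewrite !ltW// (itvP s01).
  apply: derivable_within_continuous => s s01.
  by have /psi1 : 0 <= s <= 1 by rewrite (itvP s01) (itvP s01).
rewrite subr0 mulr1 /= /p scale1r scale0r addr0 [a + _]addrC subrK => psiE.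
rewrite -Fv linearB psiE.
rewrite (le_trans (ler_norm _))// (le_trans (F1 _))//.
by apply: (df _ _).2; rewrite (itvP c01) (itvP c01).
Qed.

End mean_value.

(** * Topological direct sums *)

Section direct_sums.
Context (R : realType).

(** The two components of [s] are the projections: they are linear because the decomposition is
    unique, and continuous because [s] is. *)
Lemma direct_sum_projections (E : normedModType R) (U V : set E) :
  is_topological_direct_sum U V -> exists P Q : 'L(E, E),
    [/\ forall x, U (P x), forall x, V (Q x), forall x, P x + Q x = x,
      forall x, U x -> P x = x & forall x, V x -> P x = 0].
Proof.
move=> [[_ U0 UD] [_ V0 VD] [s [cs UVs sE sK]]].
have ls (a : R) x y :
    s (a *: x + y) = (a *: (s x).1 + (s y).1, a *: (s x).2 + (s y).2).
  have [Ux Vx] := UVs x; have [Uy Vy] := UVs y.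
  rewrite -[RHS]sK; last by split; [exact: UD|exact: VD].
  by congr s; rewrite /= addrACA -scalerDr !sE.
have PP : (fun x => (s x).1) \in @clin_pred R E E.
  apply/asboolP; split; first by move=> a x y; rewrite ls.
  by move=> x; apply: cvg_comp (cs x) _; exact: cvg_fst.
have QP : (fun x => (s x).2) \in @clin_pred R E E.
  apply/asboolP; split; first by move=> a x y; rewrite ls.
  by move=> x; apply: cvg_comp (cs x) _; exact: cvg_snd.
exists (MkClin PP), (MkClin QP); split => //= x.
- by have [] := UVs x.
- by have [] := UVs x.
- by move=> Ux; have := sK (x, 0) (conj Ux V0); rewrite /= addr0 => ->.
- by move=> Vx; have := sK (0, x) (conj U0 Vx); rewrite /= add0r => ->.
Qed.

(** [P] is the projection onto the range of [L] along [W]. A bounded preimage [x_ y] of [P y] is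
    chosen without any linearity; two preimages differ by an element of the kernel, which the
    projection [Q] onto [S] kills, so [Q \o x_] is linear and bounded. *)
Lemma split_right_inverse (X Y : normedModType R) (L : 'L(X, Y)) (c : R)
    (S : set X) (W : set Y) :
  is_topological_direct_sum (ker L) S -> is_preimage_constant L c ->
  is_topological_direct_sum (range L) W ->
  exists (P : 'L(Y, Y)) (T : 'L(Y, X)),
    [/\ forall x, P (L x) = L x, forall y, L (T y) = P y &
        forall y, P y = 0 -> W y].
Proof.
move=> /direct_sum_projections[K [Q [LK _ KQ KK _]]] [c0 Lc].
move=> /direct_sum_projections[P [P' [LP WP' PP' PK _]]].
have QK x : L x = 0 -> Q x = 0.
  by move=> Lx; apply: (addrI (K x)); rewrite KQ addr0 KK.
pose x_ y := sval (cid2 (Lc _ (LP y))).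
have Lx_ y : L (x_ y) = P y by rewrite /x_; case: cid2.
have x_le y : `|x_ y| <= c * `|P y| by rewrite /x_; case: cid2.
have [|y|T TE] := @clin_of_bounded _ _ _ (Q \o x_)
  (clin_norm Q * (c * clin_norm P)).
- move=> a y z; apply/eqP; rewrite -subr_eq0 /= -linearP -linearB; apply/eqP.
  by apply: QK; rewrite linearB linearP /= !Lx_ linearP subrr.
- rewrite /= (le_trans (clin_norm_ub _ _))// -!mulrA.
  rewrite ler_wpM2l ?clin_norm_ge0// (le_trans (x_le _))//.
  by rewrite ler_wpM2l ?(ltW c0)// clin_norm_ub.
exists P, T; split.
- by move=> x; apply: PK; exists x.
- move=> y; rewrite TE /= -Lx_ -[in RHS](KQ (x_ y)) linearD /=.
  by have /= -> := LK (x_ y); rewrite add0r.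
- by move=> y Py0; rewrite -(PP' y) Py0 add0r.
Qed.

End direct_sums.

(** * Curves in a level set of non-maximal rank *)

Section C1_strict.
Context (R : realType) (X Y : normedModType R).

(** Mean value inequality for [g - D g x0], whose differential is [e]-small on a ball by continuity
    of [D g]. *)
Lemma C1_strictly_differentiable (A : set X) (g : X -> Y) x0 (e : R) :
  open A -> C1 A g -> A x0 -> 0 < e ->
  exists2 rho : R, 0 < rho &
    (forall a, `|a - x0| < rho -> A a /\
      forall v, `|D g a v - D g x0 v| <= e * `|v|) /\
    forall a b, `|a - x0| < rho -> `|b - x0| < rho ->
      `|g a - g b - D g x0 (a - b)| <= e * `|a - b|.
Proof.
move=> oA [dg /subspace_continuousP cg] Ax0 e0.
have : \forall a \near x0, A a /\ forall v, `|D g a v - D g x0 v| <= e * `|v|.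
  have := cg _ Ax0 => /cvgrPdist_le/(_ _ e0); rewrite near_withinE => cD.
  have nA : \forall a \near x0, A a by exact: open_nbhs_nbhs.
  near=> a; have Aa : A a by near: a.
  split => // v; have := clin_norm_ub (D g x0 - D g a) v.
  rewrite -normrN opprB => /le_trans; apply; rewrite ler_wpM2r//.
  by move: Aa; near: a.
move=> /nbhs_normP[rho /= rho0 rhoP].
have {}rhoP a : `|a - x0| < rho -> A a /\
    forall v, `|D g a v - D g x0 v| <= e * `|v|.
  by move=> ax0; apply: rhoP; rewrite /= distrC.
exists rho => //; split => // a b ax0 bx0.
pose k := g \- D g x0.
have -> : g a - g b - D g x0 (a - b) = k a - k b.
  by rewrite /k /= linearB !opprB [D g x0 b - _]addrC addrACA [- g b + _]addrC.
apply: mean_value_inequality => s /andP[s0 s1].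
set p := b + s *: (a - b).
have px0 : `|p - x0| < rho.
  have -> : p - x0 = (1 - s) *: (b - x0) + s *: (a - x0).
    rewrite scalerBl scale1r -[RHS]addrA -scalerN -scalerDr /p addrAC.
    by rewrite opprB [_ + (a - x0)]addrC addrA subrK.
  rewrite (le_lt_trans (ler_normD _ _))// !normrZ (ger0_norm s0).
  rewrite ger0_norm ?subr_ge0//.
  have [->|s_neq0] := eqVneq s 0; first by rewrite subr0 mul1r mul0r addr0.
  have s_gt0 : 0 < s by rewrite lt_neqAle eq_sym s_neq0.
  have h1 : (1 - s) * `|b - x0| <= (1 - s) * rho.
    by rewrite ler_wpM2l ?subr_ge0// ltW.
  have h2 : s * `|a - x0| < s * rho by rewrite ltr_pM2l.
  have h3 : rho = (1 - s) * rho + s * rho by ring.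
  by lra.
have [Ap Dp] := rhoP _ px0.
have dDx0 : is_diff p (D g x0) (D g x0).
  apply: DiffDef; first exact/linear_differentiable/clin_continuous.
  exact/diff_lin/clin_continuous.
have dgp := differentiableP (dg _ Ap).
have dk : is_diff p k (('d g p : X -> Y) - (D g x0 : X -> Y)) by exact: is_diffB.
split; first exact: ex_diff.
rewrite diff_val -(DE (dg _ Ap)).
exact: Dp.
Unshelve. all: by end_near. Qed.

End C1_strict.

Section fixed_point.
Context (R : realType) (Y : completeNormedModType R).

Lemma half_contraction_fixed_point (Phi : Y -> Y) (rho : R) :
  0 <= rho -> (forall y, `|y| <= rho -> `|Phi y| <= rho) ->
  (forall y z, `|y| <= rho -> `|z| <= rho -> `|Phi y - Phi z| <= 2^-1 * `|y - z|) ->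
  exists2 y, `|y| <= rho & y = Phi y.
Proof.
move=> rho0 Phirho Phi2.
pose U := [set y : Y | `|y| <= rho].
have PhiU : set_fun U U Phi by move=> y; exact: Phirho.
pose PhiM := isFun.Build _ _ U U Phi PhiU.
pose F : {fun U >-> U} := HB.pack Phi PhiM.
apply: (@banach_fixed_point R Y U F).
- exists (2^-1)%:nng; split => /=; first by rewrite invf_lt1// ltr1n.
  by move=> [y z] [/= Uy Uz]; exact: Phi2.
- rewrite (_ : U = closed_ball_ Num.norm 0 rho).
    exact: closed_closed_ball_.
  by apply/seteqP; split => y; rewrite /U /closed_ball_ /= sub0r normrN.
- by exists 0; rewrite /U /= normr0.
Qed.

End fixed_point.

Section perturbed_range.
Context (R : realType) (X : normedModType R) (Y : completeNormedModType R).
Context (L : 'L(X, Y)) (P : 'L(Y, Y)) (T : 'L(Y, X)) (MP MT e : R).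
Hypothesis PL : forall x, P (L x) = L x.
Hypothesis LT : forall y, L (T y) = P y.
Hypotheses (MP0 : 0 < MP) (MT0 : 0 < MT).
Hypothesis PM : forall y, `|P y| <= MP * `|y|.
Hypothesis TM : forall y, `|T y| <= MT * `|y|.
Hypothesis eE : MP * e * MT = 2^-1.

Let PP y : P (P y) = P y. Proof. by rewrite -(LT y) PL. Qed.

(* [MP * e * MT = 1/2] makes [q |-> P (q - L' (T q) + b)] a contraction. *)
Lemma perturbed_range_solution (L' : 'L(X, Y)) (b : Y) :
  (forall v, `|L' v - L v| <= e * `|v|) ->
  exists2 q, `|q| <= 2 * MP * `|b| & P (L' (T q)) = P b.
Proof.
move=> L'L.
pose Phi q := P (q - L' (T q) + b).
have PhiB q r : `|Phi q - Phi r| <= 2^-1 * `|q - r|.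
  have -> : Phi q - Phi r = P (L (T (q - r)) - L' (T (q - r))).
    rewrite [RHS]linearB /= LT PP -linearB /Phi -linearB; congr (P _).
    rewrite opprD addrACA subrr addr0 opprD addrACA -opprD.
    by rewrite (linearB T) (linearB L').
  rewrite (le_trans (PM _))// -normrN opprB.
  rewrite -eE -!mulrA (ler_wpM2l (ltW MP0))//.
  rewrite (le_trans (L'L _))// ler_wpM2l//.
  have : 0 < MP * e * MT by rewrite eE.
  by rewrite -mulrA pmulr_rgt0// pmulr_lgt0// => /ltW.
have Phi0 : `|Phi 0| <= MP * `|b|.
  by rewrite /Phi (linear0 T) (linear0 L') subr0 add0r.
(* The ball is stable: [|Phi y|] is at most [|Phi 0| + |y| / 2], and each summand is at most
   [MP * |b|]. *)
have [q qb qE] : exists2 q, `|q| <= 2 * MP * `|b| & q = Phi q.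
  apply: half_contraction_fixed_point => [|y yb|y z _ _]; last exact: PhiB.
    by rewrite !mulr_ge0// ltW.
  have := PhiB y 0; rewrite subr0 => h.
  rewrite -(subrK (Phi 0) (Phi y)) (le_trans (ler_normD _ _))//.
  move: h Phi0 yb; lra.
(* A fixed point lies in the range of the idempotent [P], so [q] cancels from [q = Phi q]. *)
exists q => //; have Pq : P q = q by rewrite [in LHS]qE [RHS]qE /Phi PP.
move: (etrans Pq qE); rewrite /Phi linearD linearB /= -addrA => /eqP.
by rewrite addrC -subr_eq subrr eq_sym addrC subr_eq0 eq_sym => /eqP.
Qed.

End perturbed_range.

Section tangent_curve.
Context (R : realType) (X : normedModType R) (Y : completeNormedModType R).
Context (A : set X) (g : X -> Y) (x0 h : X) (P : 'L(Y, Y)) (T : 'L(Y, X)).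
Let L := D g x0.
Hypotheses (oA : open A) (Cg : C1 A g) (Ax0 : A x0) (gx0 : g x0 = 0).
Hypothesis PL : forall x, P (L x) = L x.
Hypothesis LT : forall y, L (T y) = P y.
Hypothesis kerPD : \forall x \near x0, forall v, P (D g x v) = 0 -> D g x v = 0.
Hypothesis Lh : L h = 0.

Let PP y : P (P y) = P y. Proof. by rewrite -(LT y) PL. Qed.

(** The curve is [x0 + s h + T (y s)] with [y s] the fixed point of [Phi s], which encodes
    [P (g (c s)) = 0]. The curve is only shown to be Lipschitz, yet [kerPD] makes the derivative of
    [g \o c] vanish, so [g] stays equal to [g x0 = 0] along it. *)
Lemma tangent_curve : exists c : R -> X,
  (\forall s \near 0, A (c s) /\ g (c s) = 0) /\
  forall e : R, 0 < e ->
    \forall s \near 0, `|c s - x0 - s *: h| <= e * `|s|.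
Proof.
have [MP MP0 PM] := clin_bound_gt0 P.
have [MT MT0 TM] := clin_bound_gt0 T.
(* This tolerance gives the contraction factor 1/2, both for [Phi s] and in
   [perturbed_range_solution]. *)
pose e := (2 * MP * MT)^-1.
have e0 : 0 < e by rewrite invr_gt0 !mulr_gt0.
have eE : MP * e * MT = 2^-1.
  by rewrite /e; field; rewrite !gt_eqF.
have [rho1 rho10 [rho1D rho1g]] := C1_strictly_differentiable oA Cg Ax0 e0.
have /nbhs_normP[rho2 /= rho20 kerrho2] := kerPD.
pose rho := Num.min rho1 rho2.
have rho0 : 0 < rho by rewrite lt_min rho10.
have rhoA x : `|x - x0| < rho -> A x.
  by rewrite lt_min => /andP[/rho1D[]].
have rhoD x v : `|x - x0| < rho -> `|D g x v - L v| <= e * `|v|.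
  by rewrite lt_min => /andP[/rho1D[_]].
have rhoker x v : `|x - x0| < rho -> P (D g x v) = 0 -> D g x v = 0.
  by rewrite lt_min => /andP[_ xx0]; apply: kerrho2; rewrite /= distrC.
pose x s y := x0 + (s *: h + T y).
pose Phi s y := P (y - g (x s y)).
have xB s y s' y' : x s y - x s' y' = (s - s') *: h + T (y - y').
  by rewrite /x opprD addrACA subrr add0r opprD addrACA scalerBl linearB.
have x00 : x 0 0 = x0 by rewrite /x scale0r linear0 !addr0.
(* Since [L h = 0] and [L T = P], differences of [Phi] reduce to the first-order remainder of [g],
   which strict differentiability controls. *)
have PhiB s y s' y' :
    Phi s y - Phi s' y' = - P (g (x s y) - g (x s' y') - L (x s y - x s' y')).
  rewrite /Phi -(linearB P) xB (clin_linear L) Lh scaler0 add0r LT.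
  rewrite (linearB P (g _ - g _)) /= PP [RHS]opprB -[RHS](linearB P) /=.
  congr (P _).
  by rewrite opprD addrACA -opprD.
have Phi00 : Phi 0 0 = 0 by rewrite /Phi x00 gx0 subr0 linear0.
have PhiM s y s' y' : `|x s y - x0| < rho -> `|x s' y' - x0| < rho ->
    `|Phi s y - Phi s' y'| <=
      (2 * MT)^-1 * `|s - s'| * `|h| + 2^-1 * `|y - y'|.
  rewrite !lt_min => /andP[+ _] /andP[+ _] => xs xs'.
  rewrite PhiB normrN (le_trans (PM _))//.
  rewrite (@le_trans _ _ (MP * (e * (`|s - s'| * `|h| + MT * `|y - y'|))))//.
    rewrite ler_pM2l// (le_trans (rho1g _ _ xs xs'))// ler_pM2l// xB.
    by rewrite (le_trans (ler_normD _ _))// normrZ lerD.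
  rewrite le_eqVlt; apply/orP; left; apply/eqP; rewrite /e.
  by field; rewrite !gt_eqF.
(* With [del] and [rhoY], both [|s h|] and [|T y|] are at most [rho / 4], which keeps [x s y] in the
   ball of radius [rho]. The summand 1 covers [h = 0]. *)
pose del := rho / (4 * (`|h| + 1)).
have h1 : 0 < `|h| + 1 by rewrite ltr_wpDl.
have del0 : 0 < del by rewrite divr_gt0// mulr_gt0.
pose rhoY := rho / (4 * MT).
have rhoY0 : 0 < rhoY by rewrite divr_gt0// mulr_gt0.
have del_h (s : R) : `|s| < del -> `|s| * `|h| <= rho / 4.
  move=> sdel; have : `|s| * (`|h| + 1) <= del * (`|h| + 1).
    by rewrite ler_pM2r// ltW.
  rewrite (_ : del * _ = rho / 4); last by rewrite /del; field; rewrite gt_eqF.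
  by apply: le_trans; rewrite ler_wpM2l// lerDl.
have x_rho (s : R) (y : Y) : `|s| < del -> `|y| <= rhoY -> `|x s y - x0| < rho.
  move=> /del_h sh yrho; rewrite -{1}x00 xB !subr0.
  rewrite (le_lt_trans (ler_normD _ _))// normrZ.
  have : `|T y| <= MT * rhoY by rewrite (le_trans (TM _))// ler_pM2l.
  rewrite (_ : MT * rhoY = rho / 4); last by rewrite /rhoY; field; rewrite gt_eqF.
  by move: sh rho0; lra.
(* For [|s| >= del] the requirement is void and [0] serves as default value. *)
have /choice[y_ y_P] : forall s : R, exists y, `|s| < del ->
    `|y| <= rhoY /\ y = Phi s y.
  move=> s; have [sdel|] := ltP `|s| del; last first.
    by exists 0.
  have [||y z yrho zrho|y yrho yPhi] :=
    @half_contraction_fixed_point R Y (Phi s) rhoY; last by exists y.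
  - exact: ltW.
  - move=> y yrho; rewrite -(subr0 (Phi s y)) -Phi00.
    rewrite (le_trans (PhiM _ _ _ _ _ _)) ?x_rho ?normr0//; first exact: ltW.
    rewrite !subr0 -mulrA.
    have : (2 * MT)^-1 * (`|s| * `|h|) <= (2 * MT)^-1 * (rho / 4).
      by rewrite ler_wpM2l ?del_h// invr_ge0 ltW// mulr_gt0.
    rewrite (_ : _ * (rho / 4) = 2^-1 * rhoY); last first.
      by rewrite /rhoY; field; rewrite gt_eqF.
    by move: yrho; lra.
  - rewrite (le_trans (PhiM _ _ _ _ _ _)) ?x_rho//.
    by rewrite subrr normr0 mulr0 mul0r add0r.
pose c s := x s (y_ s).
have c_rho (s : R) : `|s| < del -> `|c s - x0| < rho.
  by move=> sdel; apply: x_rho => //; case: (y_P _ sdel).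
(* Both [y_ s] and [y_ s'] are fixed points, so the term [|y_ s - y_ s'| / 2] of [PhiM] is absorbed
   on the left: [y_] is Lipschitz. *)
have yM (s s' : R) : `|s| < del -> `|s'| < del ->
    MT * `|y_ s - y_ s'| <= `|s - s'| * `|h|.
  move=> sdel sdel'.
  have := PhiM _ _ _ _ (c_rho _ sdel) (c_rho _ sdel').
  have [_ <-] := y_P _ sdel; have [_ <-] := y_P _ sdel'.
  rewrite -(ler_pM2l MT0) => H.
  have : MT * ((2 * MT)^-1 * `|s - s'| * `|h| + 2^-1 * `|y_ s - y_ s'|) =
    2^-1 * (`|s - s'| * `|h|) + 2^-1 * (MT * `|y_ s - y_ s'|).
    by field; rewrite gt_eqF.
  by move: H; lra.
have cM (s s' : R) : `|s| < del -> `|s'| < del ->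
    `|c s - c s'| <= 2 * `|h| * `|s - s'|.
  move=> sdel sdel'; rewrite /c xB (le_trans (ler_normD _ _))// normrZ.
  by have := TM (y_ s - y_ s'); have := yM _ _ sdel sdel'; lra.
have del00 : `|0 : R| < del by rewrite normr0.
have y0 : y_ 0 = 0.
  have [_ y0E] := y_P _ del00.
  have := PhiM 0 (y_ 0) 0 0 (c_rho _ del00); rewrite x00 subrr normr0 => /(_ rho0).
  rewrite -y0E Phi00 !subr0 normr0 mulr0 mul0r add0r => H.
  by apply/eqP; rewrite -normr_le0; move: H; have := normr_ge0 (y_ 0); lra.
have c0 : c 0 = x0 by rewrite /c y0 x00.
have h20 : 0 < 2 * `|h| + 1 by rewrite ltr_wpDl// mulr_ge0.
have cM' (s s' : R) : `|s| < del -> `|s'| < del ->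
    `|c s - c s'| <= (2 * `|h| + 1) * `|s - s'|.
  move=> sdel sdel'; rewrite (le_trans (cM _ _ sdel sdel'))// ler_wpM2r//.
  by rewrite lerDl.
have near_del (s : R) : `|s| < del -> \forall s' \near s, `|s'| < del.
  move=> sdel; apply/nbhs_normP; exists (del - `|s|); first by rewrite /= subr_gt0.
  move=> s' /=; have := ler_distD s s' 0; rewrite !subr0 distrC; lra.
have near_lt (s r : R) : 0 < r ->
    \forall s' \near s, (2 * `|h| + 1) * `|s' - s| < r.
  move=> r0; apply/nbhs_normP; exists (r / (2 * `|h| + 1)).
    by rewrite /= divr_gt0.
  by move=> s' /=; rewrite ltr_pdivlMr// mulrC distrC.
exists c; split; last first.
  move=> e1 e10.
  (* The deviation from the tangent is [T (y_ s)], and [y_ s] is minus [P] of a remainder of [g];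
     [e2] offsets the bounds of [T] and [P] and the Lipschitz constant of [c]. *)
  pose e2 := e1 / (MT * MP * (2 * `|h| + 1)).
  have e20 : 0 < e2 by rewrite divr_gt0// !mulr_gt0.
  have [rho3 rho30 [_ rho3g]] := C1_strictly_differentiable oA Cg Ax0 e20.
  have := near_lt 0 _ rho30; have := near_del _ del00.
  apply: filterS2 => s sdel srho3.
  have := cM' _ _ sdel del00; rewrite c0 => csM.
  have -> : c s - x0 - s *: h = T (y_ s).
    by rewrite /c /x [x0 + _]addrC addrK [_ + T _]addrC addrK.
  rewrite (le_trans (TM _))//.
  have [_ ->] := y_P _ sdel.
  rewrite -[Phi _ _]subr0 -Phi00 PhiB normrN x00.
  have H := rho3g (c s) x0 (le_lt_trans csM srho3).
  rewrite subrr normr0 in H.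
  have {}H := le_trans (H rho30) (ler_wpM2l (ltW e20) csM).
  have := ler_wpM2l (ltW MT0) (le_trans (PM _) (ler_wpM2l (ltW MP0) H)).
  move=> /le_trans; apply; rewrite le_eqVlt; apply/orP; left; apply/eqP.
  by rewrite /e2 subr0; field; rewrite !gt_eqF.
have Pg (s : R) : `|s| < del -> P (g (c s)) = 0.
  move=> sdel; have [_ yE] := y_P _ sdel.
  have Py : P (y_ s) = y_ s by rewrite yE PP.
  move: (etrans Py yE); rewrite /Phi linearB /= => /eqP.
  by rewrite -subr_eq0 opprB addrCA subrr addr0 => /eqP.
(* Let [b] be the remainder of [g] along [w = c s' - c s]. As [P g] vanishes on the curve,
   [P b = - P (L' w)]; correcting [w] by some [T q] of size [O(|b|)] gives [L' (w + T q) = 0]. The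
   increment of [g] is then [b - L' (T q)], bounded by [K * |b| = o(s' - s)]. *)
have dg (s : R) : `|s| < del -> differentiable (g \o c) s /\
    'd (g \o c) s = (0 : 'L(R^o, Y)) :> (R -> Y).
  move=> sdel; apply: near_differentiable => eta eta0.
  have xrho := c_rho _ sdel.
  pose L' := D g (c s).
  pose K := 1 + clin_norm L' * (MT * (2 * MP)).
  have K0 : 0 < K.
    by rewrite ltr_wpDr// !mulr_ge0 ?clin_norm_ge0// ltW.
  pose eta' := eta / (K * (2 * `|h| + 1)).
  have eta'0 : 0 < eta' by rewrite divr_gt0// mulr_gt0.
  have dgx : differentiable g (c s) by apply: Cg.1; exact: rhoA.
  have /nbhs_normP[r /= r0 rP] := differentiable_near dgx eta'0.
  have := near_lt s _ r0; have := near_del _ sdel; apply: filterS2 => s' sdel' ss'r.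
  have css' := cM' _ _ sdel' sdel.
  have := rP (c s'); rewrite /= distrC => /(_ (le_lt_trans css' ss'r)).
  rewrite -(DE dgx) -/L'.
  set w := c s' - c s; set b := _ - L' w => bM.
  (* [c s' - c s + T q] is a direction which [D g (c s)] maps into the kernel
     of [P], hence to [0]. *)
  have [q qM qE] := perturbed_range_solution PL LT MP0 MT0 PM TM eE b
    (fun v => rhoD _ v xrho).
  have L'w : L' w = - L' (T q).
    apply/eqP; rewrite -addr_eq0 -linearD; apply/eqP/(rhoker _ _ xrho).
    rewrite (linearD L') (linearD P) /= qE -(linearD P) /b addrC subrK.
    by rewrite linearB /= !Pg// subrr.
  have -> : (g \o c) s' - (g \o c) s - (0 : 'L(R^o, Y)) (s' - s) = b - L' (T q).
    by rewrite -L'w /b subrK [X in _ - X](_ : _ = 0)// subr0.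
  have : `|b - L' (T q)| <= K * `|b|.
    rewrite (le_trans (ler_normB _ _))// /K mulrDl mul1r lerD2l.
    rewrite (le_trans (clin_norm_ub _ _))// -mulrA ler_wpM2l ?clin_norm_ge0//.
    by rewrite (le_trans (TM _))// -mulrA ler_wpM2l// ltW.
  move=> /le_trans; apply.
  have := ler_wpM2l (ltW K0) (le_trans bM (ler_wpM2l (ltW eta'0) css')).
  move=> /le_trans; apply; rewrite le_eqVlt; apply/orP; left; apply/eqP.
  by rewrite /eta'; field; rewrite !gt_eqF.
have := near_del _ del00; apply: filterS => s sdel.
split; first exact/rhoA/c_rho.
apply/eqP; rewrite -normr_le0 -(subr0 (g _)) -[X in _ - X]gx0 -c0.
apply: (@mean_value_inequality _ R^o _ (g \o c)) => r /andP[r0 r1].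
rewrite add0r subr0.
have [|dr ->] := dg (r *: s); last by rewrite normr0.
by rewrite (le_lt_trans _ sdel)// normrM ger0_norm// ler_piMl.
Qed.

End tangent_curve.

(** * Multipliers *)

Section multiplier.
Context (R : realType) (X Y : normedModType R).

(** The curve is two-sided: comparing the values at small [s] and [- s] bounds the derivative along
    [h] by half its own absolute value. *)
Lemma critical_along_tangent_curve (f : X -> R^o) x0 h (c : R -> X) :
  differentiable f x0 ->
  (forall e : R, 0 < e -> \forall s \near 0, `|c s - x0 - s *: h| <= e * `|s|) ->
  (\forall s \near 0, f (c s) <= f x0) ->
  D f x0 h = 0.
Proof.
move=> df ctan fmax; apply: contrapT => /eqP; rewrite -normr_gt0 => d0.
set d := `|_| in d0.
have [M M0 DM] := clin_bound_gt0 (D f x0).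
have h10 : 0 < `|h| + 1 by rewrite ltr_wpDl.
(* The remainder of [f] and the deviation of [c] from its tangent each cost at most [d / 4 * |s|];
   [e2 <= 1] also gives [|c s - x0| <= (|h| + 1) |s|]. *)
pose e1 := d / (4 * (`|h| + 1)); have e10 : 0 < e1 by rewrite divr_gt0// mulr_gt0.
pose e2 := Num.min 1 (d / (4 * M)).
have e20 : 0 < e2 by rewrite lt_min ltr01 divr_gt0// mulr_gt0.
have /nbhs_normP[r1 /= r10 fr1] := differentiable_near df e10.
have key : \forall s \near (0 : R), s * D f x0 h <= d / 2 * `|s|.
  have nr1 : \forall s \near (0 : R), (`|h| + 1) * `|s| < r1.
    apply/nbhs_normP; exists (r1 / (`|h| + 1)); first by rewrite /= divr_gt0.
    by move=> s /=; rewrite sub0r normrN ltr_pdivlMr// mulrC.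
  near=> s.
  have cs : `|c s - x0 - s *: h| <= e2 * `|s| by near: s; exact: ctan.
  have csx0 : `|c s - x0| <= (`|h| + 1) * `|s|.
    rewrite -(subrK (s *: h) (c s - x0)) (le_trans (ler_normD _ _))//.
    rewrite normrZ mulrDl mul1r addrC mulrC lerD2l (le_trans cs)//.
    by rewrite ler_piMl// ge_min lexx.
  have sr1 : (`|h| + 1) * `|s| < r1 by near: s.
  have := fr1 (c s); rewrite /= distrC => /(_ (le_lt_trans csx0 sr1)).
  rewrite -(DE df) => fD.
  have fs : f (c s) <= f x0 by near: s.
  have -> : s * D f x0 h = D f x0 (c s - x0) - D f x0 (c s - x0 - s *: h).
    have := clin_linear (D f x0) s h (c s - x0 - s *: h).
    by rewrite [s *: h + _]addrC subrK => ->; rewrite addrK.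
  have := le_trans fD (ler_wpM2l (ltW e10) csx0).
  have -> : e1 * ((`|h| + 1) * `|s|) = d / 4 * `|s|.
    by rewrite /e1; field; rewrite gt_eqF.
  rewrite ler_norml => /andP[H1 _].
  have : `|D f x0 (c s - x0 - s *: h)| <= d / 4 * `|s|.
    rewrite (le_trans (DM _))//.
    rewrite (le_trans (ler_wpM2l (ltW M0) cs))// mulrA ler_wpM2r//.
    have -> : d / 4 = M * (d / (4 * M)) by field; rewrite gt_eqF.
    by rewrite ler_pM2l// ge_min lexx orbT.
  rewrite ler_norml => /andP[H2 _].
  by move: H1 H2 fs; lra.
have /nbhs_normP[r /= r0 rP] := key.
have r20 : 0 < r / 2 by rewrite divr_gt0.
have h1 := rP (r / 2); rewrite /= sub0r normrN gtr0_norm// in h1.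
have h2 := rP (- (r / 2)); rewrite /= sub0r opprK normrN gtr0_norm// in h2.
have rr : r / 2 < r by lra.
have : `|r / 2 * D f x0 h| <= d / 2 * (r / 2).
  by rewrite ler_norml h1// andbT lerNl -mulNr h2.
rewrite normrM gtr0_norm// -/d mulrC ler_pM2r//; lra.
Unshelve. all: by end_near. Qed.

(** On the range of [L], [w] factors through [L] since it vanishes on the kernel; evaluating it at a
    preimage controlled by [c] bounds the factor by [c * |w|], and Hahn-Banach extends it without
    increasing this bound. *)
Lemma lagrange_multiplier (L : 'L(X, Y)) (w : 'L(X, R^o)) (c : R) :
  is_preimage_constant L c -> (forall x, L x = 0 -> w x = 0) ->
  exists p : 'L(Y, R^o), (forall x, p (L x) = w x) /\ `|p| <= c * `|w|.
Proof.
move=> [c0 Lc] w0.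
have cw0 : 0 <= c * `|w| by rewrite mulr_ge0// ltW.
have [|p [pM pL]] := @hahn_banach R Y (c * `|w|) (range (fun x => (L x, w x))) cw0.
  split; first by exists 0; rewrite // !linear0.
    by move=> a _ _ [x _ <-] [y _ <-]; exists (a *: x + y); rewrite // !linearP.
  move=> _ [x _ <-] /=.
  have [|x' Lx' x'M] := Lc (L x); first by exists x.
  have -> : w x = w x'.
    apply/eqP; rewrite -subr_eq0 -linearB; apply/eqP/w0.
    by rewrite linearB /= Lx' subrr.
  rewrite (le_trans (clin_norm_ub _ _))// -mulrA mulrCA.
  by rewrite ler_wpM2l// clin_norm_ge0.
exists p; split; first by move=> x; apply: pL; exists x.
exact: clin_norm_le.
Qed.

End multiplier.

(** * Series: geometric domination and change of two terms *)

Lemma l1_geometric (R : realType) (E : normedModType R) (p : Nstar -> E) (K b : R) :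
  0 < b < 1 -> 0 <= K -> (forall t : Nstar, `|p t| <= K * b ^+ t.-1) -> l1 p.
Proof.
move=> /andP[b0 b1] K0 pK.
have Kb n : (0 <= (K * b ^+ n)%:E)%E by rewrite lee_fin mulr_ge0// exprn_ge0// ltW.
apply: (@le_lt_trans _ _ (\esum_(t in [set: Nstar]) (K * b ^+ t.-1)%:E)%E).
  by apply: le_esum => t _; rewrite lee_fin.
rewrite (@reindex_esum _ _ _ [set: nat] setT
  (fun n => MkNstar (ltn0Sn n))); last first.
  split => //; first by move=> m n _ _ [].
  by move=> [[//|n] t0] _; exists n => //; apply: val_inj.
rewrite -nneseries_esumT//=.
apply: (@le_lt_trans _ _ (K * (1 - b)^-1)%:E); last exact: ltry.
apply: lime_le; first by apply: is_cvg_nneseries.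
apply: nearW => n; rewrite sumEFin lee_fin.
apply: (@geometric_le_lim R n K b) => //.
by rewrite gtr0_norm.
Qed.

(** From index [m + 2] on, both modified terms are included and the partial sums differ by the
    constant [d]. *)
Lemma lim_series_two_terms (R : realType) (a b : R^nat) (m : nat) :
  (forall k, k != m -> k != m.+1 -> b k = a k) -> cvgn (series a) ->
  cvgn (series b) /\
  limn (series b) = limn (series a) + (b m + b m.+1 - (a m + a m.+1)).
Proof.
move=> ba ca.
set d := b m + b m.+1 - _.
have bE j : series b (j + m.+2)%N = series a (j + m.+2)%N + d.
  elim: j => [|j IH].
    rewrite /series /= !add0n !big_nat_recr//=.
    have -> : \sum_(0 <= k < m) b k = \sum_(0 <= k < m) a k.
      by apply: eq_big_nat => k /andP[_ km]; rewrite ba// ltn_eqF// leqW.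
    by rewrite /d; ring.
  rewrite addSn /series /= !big_nat_recr//= -/(series b _) -/(series a _).
  have := IH; rewrite /series /= => ->.
  rewrite ba; first by ring.
    by rewrite gtn_eqF// (leq_trans _ (leq_addl _ _)).
  by rewrite gtn_eqF// (leq_trans _ (leq_addl _ _)).
have cb : series b @ \oo --> limn (series a) + d.
  apply: (@cvg_trans _ ((series a n + d) @[n --> \oo])).
    apply: near_eq_cvg; exists m.+2 => // n /= mn.
    by rewrite -(subnK mn) bE.
  by apply: cvgD => //; exact: cvg_cst.
by split; [apply/cvg_ex; eexists; exact: cb|exact/cvg_lim].
Qed.

(** * Partial differentials on a product *)

Section partial_differentials.
Context (R : realType) (X1 X2 Y : normedModType R) (f : X1 * X2 -> Y) (z : X1 * X2).
Hypothesis df : differentiable f z.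

Lemma differentiable_fst : differentiable (fun x => f (x, z.2)) z.1.
Proof.
apply: (@differentiable_comp _ _ _ _ (fun x => (x, z.2)) f).
  by apply: differentiable_pair; [exact: ex_diff|exact: differentiable_cst].
by case: (z) df.
Qed.

Lemma differentiable_snd : differentiable (fun y => f (z.1, y)) z.2.
Proof.
apply: (@differentiable_comp _ _ _ _ (fun y => (z.1, y)) f).
  by apply: differentiable_pair; [exact: differentiable_cst|exact: ex_diff].
by case: (z) df.
Qed.

Lemma D1E h : D1 f z h = D f z (h, 0).
Proof.
rewrite /D1 (DE differentiable_fst) (DE df).
have dz : is_diff (z.1, z.2) f ('d f z).
  by move: df; case: (z) => /= z1 z2 ?; exact: differentiableP.
have dp : is_diff (z.1) (fun x => (x, z.2)) (fun h => (h, 0)).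
  exact: is_diff_pair.
by have := @diff_val _ _ _ _ _ _ _ (is_diff_comp dp dz) => /= ->.
Qed.

Lemma D2E h : D2 f z h = D f z (0, h).
Proof.
rewrite /D2 (DE differentiable_snd) (DE df).
have dz : is_diff (z.1, z.2) f ('d f z).
  by move: df; case: (z) => /= z1 z2 ?; exact: differentiableP.
have dp : is_diff (z.2) (fun y => (z.1, y)) (fun h => (0, h)).
  exact: is_diff_pair.
by have := @diff_val _ _ _ _ _ _ _ (is_diff_comp dp dz) => /= ->.
Qed.

Lemma norm_D1_le : `|D1 f z| <= `|D f z|.
Proof.
apply: clin_norm_le => [|h]; first exact: clin_norm_ge0.
rewrite D1E (le_trans (clin_norm_ub _ _))// ler_wpM2l ?clin_norm_ge0//.
by rewrite prod_normE /= normr0 ge_max lexx normr_ge0.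
Qed.

Lemma norm_D2_le : `|D2 f z| <= `|D f z|.
Proof.
apply: clin_norm_le => [|h]; first exact: clin_norm_ge0.
rewrite D2E (le_trans (clin_norm_ub _ _))// ler_wpM2l ?clin_norm_ge0//.
by rewrite prod_normE /= normr0 ge_max lexx normr_ge0.
Qed.

End partial_differentials.

(** * Variation of a single coordinate *)

Section single_variation.
Context (R : realType) (X : normedModType R) (x : linf nat X) (t : nat) (v : X).

Let update n := if n == t then v else x n.

Fact linf_update_subproof : update \in @linf_pred nat R X.
Proof.
apply/asboolP/bounded_funE; exists (`|v| + `|x|) => n; rewrite /update.
case: ifP => _; first by rewrite lerDl.
by rewrite (le_trans (linf_norm_ub x n))// lerDr.
Qed.

Definition linf_update : linf nat X := MkLinf linf_update_subproof.

Lemma linf_updateE n : linf_update n = if n == t then v else x n.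
Proof. by []. Qed.

Lemma ball_linf_update (r : R) : `|x t - v| < r -> ball x r linf_update.
Proof.
move=> xvr; rewrite -ball_normE /=; apply: le_lt_trans xvr.
apply: linf_norm_le => // n.
rewrite -[_ n]/(x n - linf_update n) linf_updateE.
by case: eqP => [->//|_]; rewrite subrr normr0.
Qed.

End single_variation.

(** Changing [x t] alone affects only the terms of index [t - 1] and [t], so the new series still
    converges and optimality compares just these two. As [t > 0], the initial condition is kept. *)
Lemma solution_single_variation (R : realType) (X Y : normedModType R)
    (A : set X) (u : nat -> X * X -> R^o) (g : Nstar -> X -> Y)
    (sigma : X) (beta : R) (x : linf nat X) (t : Nstar) (v : X) :
  is_solution A u g sigma beta x -> A v -> g t v = 0 ->
  beta ^+ t * u t (v, x t.+1) + beta ^+ t.-1 * u t.-1 (x t.-1, v) <=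
  beta ^+ t * u t (x t, x t.+1) + beta ^+ t.-1 * u t.-1 (x t.-1, x t).
Proof.
move=> [[xA x0 gx] cx xmax] Av gv.
pose y := linf_update x t v.
have fy : feasible A g sigma y.
  split => [n||s].
  - by rewrite linf_updateE; case: ifP.
  - by rewrite linf_updateE eq_sym gtn_eqF//; exact: Nstar_gt0.
  - by rewrite linf_updateE; case: eqP => [/val_inj ->|].
have tE : t.-1.+1 = t by rewrite prednK//; exact: Nstar_gt0.
have tt1 : (t.-1 == t) = false by rewrite -{2}tE ltn_eqF.
have tt2 : (t.+1 == t) = false by rewrite gtn_eqF.
have [|cy Jy] := @lim_series_two_terms R
    (fun n => beta ^+ n * u n (x n, x n.+1))
    (fun n => beta ^+ n * u n (y n, y n.+1)) t.-1 _ cx.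
  move=> k; rewrite tE => k1 k2.
  rewrite !linf_updateE (negbTE k2) ifF//.
  by apply/negbTE; rewrite -tE eqSS.
have := xmax y fy cy; rewrite /J /J_series Jy gerDl subr_le0.
by rewrite tE !linf_updateE eqxx tt1 tt2 addrC [leRHS]addrC.
Qed.

Lemma differentiable_lincomb (R : realType) (X Y : normedModType R)
    (a b : R) (f1 f2 : X -> Y) (x : X) :
  differentiable f1 x -> differentiable f2 x ->
  differentiable (fun v => a *: f1 v + b *: f2 v) x /\
  D (fun v => a *: f1 v + b *: f2 v) x = a *: D f1 x + b *: D f2 x.
Proof.
move=> df1 df2.
have df : differentiable (fun v => a *: f1 v + b *: f2 v) x.
  by apply: (@differentiableD _ _ _ (a \*: f1) (b \*: f2)); exact: differentiableZ.
split => //; apply/val_inj/funext => v; rewrite -[LHS]/(D _ x v) (DE df).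
rewrite (@diffD _ _ _ (a \*: f1) (b \*: f2)); [|exact: differentiableZ..].
by rewrite !diffZ// -(DE df1) -(DE df2).
Qed.

Lemma norm_lincomb_le (R : realType) (V : normedModType R) (a b : R) :
  0 <= a -> 0 <= b -> forall x y : V, `|a *: x + b *: y| <= a * `|x| + b * `|y|.
Proof.
move=> a0 b0 x y.
by rewrite (le_trans (ler_normD _ _))// !normrZ !ger0_norm.
Qed.

(** * Existence of summable multipliers *)

Theorem theorem6p1 (R : realType) (X Y : completeNormedModType R)
  (A : set X) (A_open : open A) (A_nonempty : A !=set0)
  (u : nat -> X * X -> R^o) (g : Nstar -> X -> Y)
  (sigma : X) (sigmaA : A sigma)
  (beta : R) (beta_gt0 : 0 < beta) (beta_lt1 : beta < 1)
  (xhat : linf nat X) (xhat_sol : is_solution A u g sigma beta xhat)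
  (A1 : linf_int (A `*` A) (fun t : nat => (xhat t, xhat t.+1)))
  (A2 : forall t : nat, C1 (A `*` A) (u t))
  (A3 : forall z : linf nat (X * X)%type, (linf_set (A `*` A))° z ->
    bounded_fun (fun t : nat => u t (z t)))
  (A4 : forall z : linf nat (X * X)%type, (linf_set (A `*` A))° z ->
    bounded_fun (fun t : nat => D (u t) (z t)))
  (A5 : bounded_unif_equicontinuous (A `*` A) (fun t : nat => D (u t)))
  (A6 : (linf_set A)° xhat)
  (A7 : forall t : Nstar, C1 A (g t))
  (A8 : forall x : linf Nstar X, (linf_set A)° x ->
    bounded_fun (fun t : Nstar => g t (x t)))
  (A9 : forall x : linf Nstar X, (linf_set A)° x ->
    bounded_fun (fun t : Nstar => D (g t) (x t)))
  (A10 : bounded_unif_equicontinuous A (fun t : Nstar => D (g t)))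
  (W : Nstar -> set Y)
  (A11 : forall t : Nstar,
    [/\ exists S : set X,
          is_topological_direct_sum (ker (D (g t) (xhat t))) S,
        closed (range (D (g t) (xhat t))) &
        is_topological_direct_sum (range (D (g t) (xhat t))) (W t)])
  (A12 : exists2 c : Nstar -> R,
    forall t : Nstar, is_preimage_constant (D (g t) (xhat t)) (c t) &
    has_ubound (range c))
  (A13 : exists r : R, [/\ 0 < r, ball xhat r `<=` linf_set A &
    forall x : linf nat X, ball xhat r x ->
    forall t : Nstar, range (D (g t) (x t)) `&` W t = [set 0]]) :
  exists p : Nstar -> 'L(Y, R^o), l1 p /\
    forall t : Nstar,
      beta ^+ t *: D1 (u t) (xhat t, xhat t.+1)
        + beta ^+ t.-1 *: D2 (u t.-1) (xhat t.-1, xhat t)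
      = p t \o D (g t) (xhat t) :> (X -> R^o).
Proof.
have [[xA _ gx] _ _] := xhat_sol.
have [c cL [C cC]] := A12.
have [r [r0 _ rW]] := A13.
have [z z_int zE] := A1.
have /bounded_funE[M DM] := A4 z z_int; rewrite zE in DM.
have tE (t : Nstar) : t.-1.+1 = t by rewrite prednK//; exact: Nstar_gt0.
have du n : differentiable (u n) (xhat n, xhat n.+1).
  by apply: (A2 n).1; split; exact: xA.
pose w (t : Nstar) : 'L(X, R^o) := beta ^+ t *: D1 (u t) (xhat t, xhat t.+1)
  + beta ^+ t.-1 *: D2 (u t.-1) (xhat t.-1, xhat t).
have du1 (t : Nstar) : differentiable (u t.-1) (xhat t.-1, xhat t).
  by have := du t.-1; rewrite tE.
have DM1 (t : Nstar) : `|D (u t.-1) (xhat t.-1, xhat t)| <= M.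
  by have := DM t.-1; rewrite tE.
have wker (t : Nstar) h : D (g t) (xhat t) h = 0 -> w t h = 0.
  move=> Lh.
  (* [f] is the part of the objective that depends on coordinate [t]; its differential at [xhat t]
     is [w t]. *)
  pose f v : R^o := beta ^+ t *: u t (v, xhat t.+1)
    + beta ^+ t.-1 *: u t.-1 (xhat t.-1, v).
  have df1 := differentiable_fst (du t).
  have df2 := differentiable_snd (du1 t).
  have [df wE] := differentiable_lincomb (beta ^+ t) (beta ^+ t.-1) df1 df2.
  have [[S KS] _ RW] := A11 t.
  have [P [T [PL LT PW]]] := split_right_inverse KS (cL t) RW.
  (* (A13) speaks of sequences: it is applied to [xhat] with coordinate [t] replaced by [v], which
     stays in the ball. The kernel of [P] lies in [W t]. *)
  have kerPD v : `|xhat t - v| < r ->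
      forall k, P (D (g t) v k) = 0 -> D (g t) v k = 0.
    move=> vr k /PW Wk.
    have RW0 := rW _ (ball_linf_update vr) t.
    rewrite linf_updateE eqxx in RW0.
    have : (range (D (g t) v) `&` W t) (D (g t) v k) by split => //; exists k.
    by rewrite RW0.
  have {}kerPD : \forall v \near xhat t,
      forall k, P (D (g t) v k) = 0 -> D (g t) v k = 0.
    by apply/nbhs_normP; exists r => //; exact: kerPD.
  have [cv [cvA ctan]] := tangent_curve A_open (A7 t) (xA t) (gx t) PL LT kerPD Lh.
  rewrite /w -wE; apply: critical_along_tangent_curve df ctan _.
  apply: filterS cvA => s [Acs gcs].
  exact: solution_single_variation xhat_sol Acs gcs.
have wM (t : Nstar) : `|w t| <= 2 * M * beta ^+ t.-1.
  have b0 n : 0 <= beta ^+ n by rewrite exprn_ge0// ltW.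
  have M0 : 0 <= M by apply: le_trans (DM 0%N).
  apply: (le_trans (norm_lincomb_le (b0 _) (b0 _) _ _)).
  (* As [beta < 1], the power [t] is bounded by the power [t - 1], so both terms share one geometric
     rate. *)
  have h1 : beta ^+ t * `|D1 (u t) (xhat t, xhat t.+1)| <= beta ^+ t.-1 * M.
    rewrite ler_pM//; first by rewrite -{1}tE exprS ler_piMl// ltW.
    exact: le_trans (norm_D1_le (du t)) (DM t).
  have h2 : beta ^+ t.-1 * `|D2 (u t.-1) (xhat t.-1, xhat t)| <= beta ^+ t.-1 * M.
    by rewrite ler_wpM2l// (le_trans (norm_D2_le (du1 t))).
  have -> : 2 * M * beta ^+ t.-1 = beta ^+ t.-1 * M + beta ^+ t.-1 * M by ring.
  exact: lerD h1 h2.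
have /choice[p pP] : forall t : Nstar, exists p : 'L(Y, R^o),
    (forall x, p (D (g t) (xhat t) x) = w t x) /\ `|p| <= c t * `|w t|.
  by move=> t; apply: lagrange_multiplier (cL t) (wker t).
exists p; split; last first.
  by move=> t; apply/funext => x /=; rewrite (pP t).1.
have cC' t : c t <= C by apply: cC; exists t.
(* [C] dominates the positive constant of index 1. *)
have C0 : 0 <= C.
  by rewrite (le_trans _ (cC' (MkNstar (ltn0Sn 0))))// ltW// (cL _).1.
have M0 : 0 <= M by apply: le_trans (DM 0%N).
apply: (@l1_geometric _ _ _ (C * (2 * M)) beta); first by rewrite beta_gt0.
  by rewrite !mulr_ge0.
move=> t; rewrite (le_trans (pP t).2)// -mulrA ler_pM ?cC' ?wM//.
by rewrite ltW// (cL _).1.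
Qed.
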